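(* Let $(\Omega,\mathcal{B},P)$ be a probability space with $\mathcal{B}$ countably generated, let $\mathcal{A}\subset\mathcal{B}$ be a sub-$\sigma$-field, and let $\mu$ be a fixed regular conditional distribution for $P$ given $\mathcal{A}$. Suppose that $G=\{(x,y)\in\Omega\times\Omega:H(x)=H(y)\}$ belongs to $\mathcal{B}\otimes\mathcal{B}$. Then $H(\omega)\in\mathcal{B}$ for all $\omega\in\Omega$, and $f_B$ is $\mathcal{A}^*$-measurable for all $B\in\mathcal{B}$. If in addition $S\in\mathcal{A}_P$, then the following condition (c) is equivalent to each of the conditions (3), (a) and (b) (i.e. all four conditions are equivalent): (3) there is $A_0\in\mathcal{A}$ with $P(A_0)=1$ and $\mu(\omega)(H(\omega))\in\{0,1\}$ for all $\omega\in A_0$; (a) $f_B$ is $\mathcal{A}_P$-measurable for all $B\in\mathcal{B}$; (b) $\mathcal{A}\cap U$ is countably generated for some $U\in\mathcal{A}$ with $U\subset S$ and $P(S-U)=0$; (c) $\mathcal{A}\cap U=\mathcal{A}^*\cap U$ for some $U\in\mathcal{A}$ with $U\subset S$ and $P(S-U)=0$.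
   Context: Let $\mathbb{P}$ be the set of probability measures on $\mathcal{B}$. A regular conditional distribution for $P$ given $\mathcal{A}$ is a map $\mu:\Omega\to\mathbb{P}$ such that, for all $B\in\mathcal{B}$, the function $\omega\mapsto\mu(\omega)(B)$ is a version of $E(I_B\mid\mathcal{A})$ (in particular it is $\mathcal{A}$-measurable). A $\sigma$-field is countably generated if it is generated by one of its countable subclasses. For a $\sigma$-field $\mathcal{F}$ on $\Omega$ and $U\in\mathcal{F}$, $\mathcal{F}\cap U=\{F\cap U:F\in\mathcal{F}\}$ is the trace $\sigma$-field on $U$. $H(\omega)=\bigcap_{\omega\in A\in\mathcal{A}}A$ is the atom of $\mathcal{A}$ including $\omega$. $\mathcal{A}^*=\{B\in\mathcal{B}:B\text{ is a union of }\mathcal{A}\text{-atoms}\}$. $\mathcal{A}_P=\{A\subset\Omega:\exists A_1,A_2\in\mathcal{A}\text{ with }A_1\subset A\subset A_2\text{ and }P(A_2-A_1)=0\}$ is the completion of $\mathcal{A}$ with respect to $P|\mathcal{A}$; the only probability measure on $\mathcal{A}_P$ agreeing with $P$ on $\mathcal{A}$ is still denoted $P$. When $H(\omega)\in\mathcal{B}$ for all $\omega$, put $f_B(\omega)=\mu(\omega)(B\cap H(\omega))$ for $\omega\in\Omega$, $B\in\mathcal{B}$; $f=f_\Omega$; and $S=\{f>0\}=\{\omega\in\Omega:f(\omega)>0\}$. *)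

(* Defs.v *)
From HB Require Import structures.
From mathcomp Require Import all_boot all_order all_algebra.
From mathcomp Require Import all_classical all_reals all_analysis.
From mathcomp Require Import measurable_realfun.

Set Implicit Arguments.
Unset Strict Implicit.
Unset Printing Implicit Defensive.

Import Order.TTheory GRing.Theory Num.Theory.

Local Open Scope classical_set_scope.
Local Open Scope ereal_scope.

(* The sigma-field of the probability space is the
   canonical one of a measurableType; every other sigma-field on T is a set of
   sets F such that sigma_algebra [set: T] F. *)

(* Requiring C `<=` F makes all members of C subsets of U when F is a
   sigma-algebra on U, which <<s U, C >> needs in order to be one as well. *)
Definition countably_generated (T : Type) (U : set T) (F : set (set T)) : Prop :=
  exists C : set (set T), [/\ countable C, C `<=` F & F = <<s U, C >>].

Definition measurable_wrt (T : Type) (R : realType) (F : set (set T))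
    (g : T -> \bar R) : Prop :=
  preimage_set_system [set: T] g measurable `<=` F.

Lemma measurable_wrtE (T : pointedType) (R : realType) (F : set (set T))
    (g : T -> \bar R) : sigma_algebra [set: T] F ->
  measurable_wrt F g <-> measurable_fun [set: g_sigma_algebraType F] g.
Proof.
move=> sF; split => [h _ Y mY|h _ [Y mY <-]].
  by apply: sub_sigma_algebra; apply: h; exists Y.
by rewrite -[F](sigma_algebra_id sF); exact: h.
Qed.

Section conditioning.
Context (d : measure_display) (T : measurableType d) (R : realType).
Implicit Types (A : set (set T)) (P : probability T R)
  (mu : T -> probability T R) (B : set T).

Definition sub_sigma_field A : Prop :=
  sigma_algebra [set: T] A /\ A `<=` measurable.

Definition cond_exp_version P A (X g : T -> \bar R) : Prop :=
  [/\ measurable_wrt A g, P.-integrable [set: T] g &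
      forall C, A C -> \int[P]_(w in C) g w = \int[P]_(w in C) X w].

Definition regular_cond_distr P A mu : Prop :=
  forall B, measurable B ->
    cond_exp_version P A (fun w => (\1_B w)%:E) (fun w => mu w B).

Definition atom A (w : T) : set T := \bigcap_(C in [set C | A C /\ C w]) C.

Definition same_atom A : set (T * T) := [set xy | atom A xy.1 = atom A xy.2].

Definition star_field A : set (set T) :=
  [set B | measurable B /\ exists E : set T, B = \bigcup_(w in E) atom A w].

Definition completion_field P A : set (set T) :=
  [set B | exists A1 A2 : set T,
     [/\ A A1, A A2, A1 `<=` B, B `<=` A2 & P (A2 `\` A1) = 0]].

(* Meaningful only when the atoms of A belong to the sigma-field of T: a
   measure is a total function on set T, unconstrained on other sets. *)
Definition atom_mass A mu B (w : T) : \bar R := mu w (B `&` atom A w).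

Definition atom_support A mu : set T := [set w | 0 < atom_mass A mu [set: T] w].

End conditioning.

(* Main.v *)
(* Let D_s run through a countable pi-system generating the measurable sets.
   For x in the support S, the family (f_{D_s} x)_s determines the nonzero
   measure mu x (. `&` atom x), hence the atom of x; so on S the sets
   {f_{D_s} > q}, q rational, form a countable family separating the atoms.
   Under (a) or (c) these sets agree with members of A on some U <= S in A
   with P (S \ U) = 0; under (b) the generators of the trace play the same
   role. For a countable family in A, a.s. mu w gives each member its indicator
   at w, so that, when the family separates the atoms in U, the atom of w has
   full mass for a.e. w in U: this is (3). Conversely, if mu w (atom w) = 1 on
   U, then mu w E is the indicator of E at w for w in U and E in A^*, and (a),
   (b) and (c) follow. *)
Require Import Defs.
From HB Require Import structures.
From mathcomp Require Import all_boot all_order all_algebra.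
From mathcomp Require Import all_classical all_reals all_analysis.
From mathcomp Require Import measurable_realfun.

Set Implicit Arguments.
Unset Strict Implicit.
Unset Printing Implicit Defensive.

Import Order.TTheory GRing.Theory Num.Theory.

Local Open Scope classical_set_scope.
Local Open Scope ereal_scope.

(** * Rational thresholds and countable unions of null sets *)

Lemma lte_exists_rat (R : realType) (x y : \bar R) :
  x < y -> exists q : rat, x < (ratr q)%:E < y.
Proof.
have itv (r s : R) : (r < s)%R -> exists q : rat, r%:E < (ratr q)%:E < s%:E.
  by move/rat_in_itvoo => [q]; rewrite in_itv/= => rqs; exists q;
    rewrite !lte_fin.
case: x y => [r||] [s||]// => [|_|_|_]; first by rewrite lte_fin => /itv.
- have [q /andP[rq _]] : exists q : rat, r%:E < (ratr q)%:E < (r + 1)%:E.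
    by apply: itv; rewrite ltrDl.
  by exists q; rewrite rq ltry.
- have [q /andP[_ qs]] : exists q : rat, (s - 1)%:E < (ratr q)%:E < s%:E.
    by apply: itv; rewrite ltrBlDr ltrDl.
  by exists q; rewrite qs ltNyr.
- by exists 0%R; rewrite ltNyr ltry.
Qed.

Lemma eq_lte_rat (R : realType) (x y : \bar R) :
  (forall q : rat, (ratr q)%:E < x <-> (ratr q)%:E < y) -> x = y.
Proof.
have le (u v : \bar R) :
    (forall q : rat, (ratr q)%:E < u -> (ratr q)%:E < v) -> u <= v.
  move=> uv; rewrite leNgt; apply/negP => /lte_exists_rat[q /andP[vq /uv]].
  by rewrite ltNge (ltW vq).
by move=> xy; apply/eqP; rewrite eq_le; apply/andP; split; apply: le => q /xy.
Qed.

Lemma measure_bigcup_countType0 (d : measure_display) (T : measurableType d)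
    (R : realType) (m : {measure set T -> \bar R}%R) (I : countType)
    (N : I -> set T) :
  (forall i, measurable (N i)) -> (forall i, m (N i) = 0) ->
  m (\bigcup_i N i) = 0.
Proof.
move=> mN N0; apply/negligibleP; first exact: countable_bigcupT_measurable.
(* Natural numbers that code no element of [I] get the empty set. *)
pose N' n := oapp N set0 (choice.unpickle n).
apply: (@negligibleS _ _ _ m (\bigcup_n N' n)).
  by move=> x [i _ Nix]; exists (choice.pickle i) => //; rewrite /N' pickleK.
apply: negligible_bigcup => n; rewrite /N'.
case: choice.unpickle => [i|] /=; last exact: negligible_set0.
by apply/negligibleP => //; exact: N0.
Qed.

(** * Sigma-fields as families of sets *)

Section sigma_field.
Context (T : pointedType) (F : set (set T)).
Hypothesis sF : sigma_algebra [set: T] F.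

Lemma sigma_fieldC E : F E -> F (~` E).
Proof. by case: sF => _ FC _ /FC; rewrite setTD. Qed.

Lemma sigma_fieldT : F [set: T].
Proof. by rewrite -setC0; apply: sigma_fieldC; case: sF. Qed.

Lemma sigma_fieldI E E' : F E -> F E' -> F (E `&` E').
Proof. by rewrite -(measurable_g_measurableTypeE sF); exact: measurableI. Qed.

Lemma sigma_fieldU E E' : F E -> F E' -> F (E `|` E').
Proof. by rewrite -(measurable_g_measurableTypeE sF); exact: measurableU. Qed.

Lemma sigma_fieldD E E' : F E -> F E' -> F (E `\` E').
Proof. by rewrite -(measurable_g_measurableTypeE sF); exact: measurableD. Qed.

Lemma sigma_field_bigcup (I : countType) (E : I -> set T) :
  (forall i, F (E i)) -> F (\bigcup_i E i).
Proof.
rewrite -(measurable_g_measurableTypeE sF).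
exact: countable_bigcupT_measurable.
Qed.

Lemma sigma_field_preimage (R : realType) (g : T -> \bar R) Y :
  measurable_wrt F g -> measurable Y -> F (g @^-1` Y).
Proof. by move=> Fg mY; apply: Fg; exists Y => //; rewrite setTI. Qed.

(* Rational thresholds suffice, since [{g > r}] is the union of the
   [{g > q}] over the rationals [q > r]. *)
Lemma measurable_wrt_rat (R : realType) (g : T -> \bar R) :
  (forall q : rat, F [set w | (ratr q)%:E < g w]) -> measurable_wrt F g.
Proof.
move=> Fq; apply/(measurable_wrtE _ sF).
apply: (measurability _ (ErealGenOInfty.measurableE R)) => _ [_ [r ->] <-].
rewrite measurable_g_measurableTypeE// setTI.
rewrite (_ : _ @^-1` _ = \bigcup_(q : rat)
   if (r < ratr q)%R then [set w | (ratr q)%:E < g w] else set0).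
  by apply: sigma_field_bigcup => q; case: ifP => // _; case: sF.
apply/seteqP; split => [w /=|w [q _]] /=; last first.
  case: ifP => // rq /= qg; rewrite in_itv/= andbT.
  by apply: lt_trans qg; rewrite lte_fin.
rewrite in_itv/= andbT => rg.
have [q /andP[rq qg]] := lte_exists_rat rg.
by exists q => //; rewrite -lte_fin rq.
Qed.

End sigma_field.

(** * Atoms of a sigma-field *)

Section atoms.
Context (d : measure_display) (T : measurableType d) (A : set (set T)).
Hypothesis sA : sigma_algebra [set: T] A.

Lemma mem_atom w : atom A w w.
Proof. by move=> C []. Qed.

Lemma atom_sub C w : A C -> C w -> atom A w `<=` C.
Proof. by move=> CA Cw x; apply; split. Qed.

Lemma eq_atomP x y : atom A x = atom A y <-> (forall C, A C -> (C x <-> C y)).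
Proof.
split=> [xy C CA|xy]; last first.
  by rewrite /atom; apply: eq_bigcapl; split=> C /= [CA Cw];
    split=> //; apply/(xy C CA).
split=> [Cx|Cy]; first by apply: (atom_sub CA Cx); rewrite xy; exact: mem_atom.
by apply: (atom_sub CA Cy); rewrite -xy; exact: mem_atom.
Qed.

(** Closure under complement makes the atoms a partition: a set of [A] containing [y] but not [x]
    would have a complement containing [x] and missing [y]. *)
Lemma atom_eq x y : atom A x y -> atom A x = atom A y.
Proof.
move=> xy; apply/eq_atomP => C CA; split=> [Cx|]; first by apply: xy; split.
by apply: contraPP => Cx; apply: (xy (~` C)); split=> //; exact: sigma_fieldC.
Qed.

Lemma measurable_wrt_atom (R : realType) (g : T -> \bar R) x y :
  measurable_wrt A g -> atom A x = atom A y -> g x = g y.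
Proof.
move=> Ag /eq_atomP/(_ (g @^-1` [set g x])) [|-> //].
exact: sigma_field_preimage.
Qed.

Lemma star_fieldP B :
  star_field A B <->
  measurable B /\ forall x y, atom A x = atom A y -> B x -> B y.
Proof.
split=> [[mB [E BE]]|[mB satB]]; split=> //.
  move=> x y xy; rewrite BE => -[w Ew wx]; exists w => //.
  by rewrite (atom_eq wx) xy; exact: mem_atom.
exists B; apply/seteqP; split=> [x Bx|y [x Bx] /atom_eq xy].
  by exists x => //; exact: mem_atom.
exact: satB Bx.
Qed.

(** Separation by a family becomes a cover of the complement of the atom; when [I] is countable, it
    is enough to show each piece null. *)
Lemma atomC_bigcup (I : Type) (D : I -> set T) (U : set T) w :
  (forall x, U x -> (forall i, D i w <-> D i x) -> atom A w = atom A x) ->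
  ~` atom A w `<=` ~` U `|` \bigcup_i [set x | ~ (D i w <-> D i x)].
Proof.
move=> sep x /= wx; apply: contrapT => /not_orP[/contrapT Ux nD]; apply: wx.
rewrite (sep x Ux) => [|i]; first exact: mem_atom.
by apply: contrapT => nDi; apply: nD; exists i.
Qed.

End atoms.

(** * Countable generators *)

Lemma countable_enum (U : Type) (x0 : U) (C : set U) : countable C ->
  exists c : nat -> U, C `<=` range c /\ range c `<=` x0 |` C.
Proof.
case/pfcard_geP => [->|[f]].
  (* An empty [C] has no enumeration, hence the default value [x0]. *)
  by exists (fun=> x0); split=> // _ [_ _ <-]; left.
by exists f; rewrite image_eq; split=> // x; right.
Qed.

Lemma countable_pi_generator (d : measure_display) (T : measurableType d) :
  countably_generated [set: T] (@measurable d T) ->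
  exists D : seq nat -> set T, [/\ D [::] = [set: T], setI_closed (range D) &
    @measurable d T = <<s range D>>].
Proof.
case=> C [ctC CM CE].
have [c [Cc cC]] := countable_enum [set: T] ctC.
(* Finite intersections of generators: concatenating index sequences intersects the sets, and the
   empty sequence gives the whole space. *)
pose D s := \big[setI/setT]_(i <- s) c i.
have cM i : measurable (c i).
  case: (cC (c i)); [by exists i|move=> ->|exact: CM].
  exact: measurableT.
exists D; split.
- by rewrite /D big_nil.
- by move=> _ _ [s _ <-] [s' _ <-]; exists (s ++ s') => //; rewrite /D big_cat.
- rewrite CE; apply/seteqP; split; apply: smallest_sub.
  + exact: smallest_sigma_algebra.
  + move=> _ /Cc[i _ <-]; apply: sub_sigma_algebra.
    by exists [:: i] => //; rewrite /D big_seq1.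
  + exact: smallest_sigma_algebra.
  + move=> _ [s _ <-]; rewrite -CE /D.
    by apply: (big_ind measurable) => //; exact: measurableI.
Qed.

Lemma probability1_setIr (d : measure_display) (T : measurableType d)
    (R : realType) (Q : probability T R) (B H : set T) :
  measurable B -> measurable H -> Q H = 1 -> Q (B `&` H) = Q B.
Proof.
move=> mB mH QH; rewrite [RHS](measureDI Q mB mH).
have QC : Q (~` H) = 0 by rewrite probability_setC// QH subee.
rewrite [X in _ = X + _](_ : _ = 0) ?add0e//; apply: subset_measure0 QC.
- exact: measurableD.
- exact: measurableC.
- by move=> w [].
Qed.

(** * Probability kernels and sections *)

Section kernel_section.
Context (d : measure_display) (T : measurableType d) (R : realType).
Variable mu : T -> probability T R.
Hypothesis mmu : forall B, measurable B -> measurable_fun [set: T] (mu ^~ B).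

Let k : T -> {measure set T -> \bar R}%R := mu.

HB.instance Definition _ := isKernel.Build _ _ _ _ _ k mmu.

HB.instance Definition _ :=
  Kernel_isProbability.Build _ _ _ _ _ k (fun x => probability_setT (mu x)).

Lemma measurable_xsection_mass (G : set (T * T)) :
  measurable G -> measurable_fun [set: T] (fun x => mu x (xsection G x)).
Proof.
by move=> mG; apply: (@measurable_fun_xsection_finite_kernel _ _ _ _ _ k);
  rewrite inE.
Qed.

End kernel_section.

(** * Almost sure behaviour of the conditional distribution *)

Section regular_conditional_distribution.
Context (d : measure_display) (T : measurableType d) (R : realType)
  (P : probability T R) (A : set (set T)) (mu : T -> probability T R).
Hypothesis sA : sub_sigma_field A.
Hypothesis rmu : regular_cond_distr P A mu.

Let mA C : A C -> measurable C. Proof. by case: sA => _; exact. Qed.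

Lemma cond_distr_wrt B : measurable B -> measurable_wrt A (mu ^~ B).
Proof. by case/rmu. Qed.

Lemma cond_distr_measurable B :
  measurable B -> measurable_fun [set: T] (mu ^~ B).
Proof.
move=> mB _ Y mY; rewrite setTI; apply: mA.
by apply: (sigma_field_preimage (cond_distr_wrt mB)).
Qed.

Lemma eq_atom_cond_distr x y B :
  atom A x = atom A y -> measurable B -> mu x B = mu y B.
Proof.
by move=> xy mB;
  exact: (measurable_wrt_atom (g := mu ^~ B) (cond_distr_wrt mB) xy).
Qed.

(** Over [D] both [mu w D] and 1 integrate to [P D], so the nonnegative function [1 - mu w D] has
    integral zero there. *)
Lemma cond_distr1_ae D : A D -> P (D `&` [set w | mu w D != 1]) = 0.
Proof.
move=> CA; have mD := mA CA.
have [_ imu /(_ D CA) intD] := rmu mD.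
have mmu := cond_distr_measurable mD.
have imuD : P.-integrable D (mu ^~ D) by exact: integrableS (subsetT _) imu.
have i1 : P.-integrable D (cst 1).
  by exact: (finite_measure_integrable_cst P 1%R).
have int0 : \int[P]_(w in D) `|1 - mu w D| = 0.
  rewrite (eq_integral (fun w => 1 - mu w D)); last first.
    by move=> w _;
      rewrite gee0_abs // sube_ge0 ?probability_le1 // fin_num_measure.
  rewrite (integralB mD i1 imuD)// integral_cst// mul1e intD integral_indic//
    setIid subee//.
  exact: fin_num_measure.
have m1 : measurable_fun D (fun w => 1 - mu w D).
  apply: emeasurable_funB; first exact: measurable_cst.
  exact: measurable_funTS.
have [N [mN N0 DN]] := (ae_eq_integral_abs P mD m1).1 int0.
apply: subset_measure0 N0 => //.
  by apply: emeasurable_neq => //; exact: measurable_funTS.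
move=> w [Dw] /= /eqP muw; apply: DN => /= /(_ Dw) e; apply: muw.
have : mu w D \is a fin_num by exact: fin_num_measure.
by move: e; case: (mu w D) => //= r [] /eqP; rewrite subr_eq0 => /eqP <-.
Qed.

(** [cond_distr1_ae] for [D i] settles the points of [D i], and for its complement the other points;
    countability of [I] keeps the union of the exceptional sets null and in [A]. *)
Lemma cond_distr_indic_ae (I : countType) (D : I -> set T) :
  (forall i, A (D i)) ->
  exists N, [/\ A N, P N = 0 &
    forall w, ~ N w -> forall i, mu w (D i) = (\1_(D i) w)%:E].
Proof.
move=> AD; have mD i := mA (AD i); have sF := sA.1.
pose N E := E `&` [set w | mu w E != 1].
have AN E : A E -> A (N E).
  move=> AE; apply: sigma_fieldI => //.
  have -> : [set w | mu w E != 1] = ~` ((mu ^~ E) @^-1` [set 1]).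
    by apply/seteqP; split=> w /= /eqP.
  apply: sigma_fieldC => //; apply: sigma_field_preimage => //.
  exact/cond_distr_wrt/mA.
have NC0 i : A (~` D i) by exact: sigma_fieldC.
exists (\bigcup_i (N (D i) `|` N (~` D i))); split.
- by apply: sigma_field_bigcup => // i; apply: sigma_fieldU => //; exact: AN.
- apply: measure_bigcup_countType0 => i.
    by apply: mA; apply: sigma_fieldU => //; exact: AN.
  by apply: null_set_setU; (exact/mA/AN || exact: cond_distr1_ae).
move=> w nN i; rewrite indicE; have [Dw|Dw] := pselect (D i w).
  rewrite mem_set//; apply/eqP; apply: contra_notT nN => ne.
  by exists i => //; left; split.
rewrite (memNset Dw); have : mu w (~` D i) = 1.
  by apply/eqP; apply: contra_notT nN => ne; exists i => //; right; split=> //.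
rewrite probability_setC//.
have : mu w (D i) \is a fin_num by exact: fin_num_measure.
case: (mu w (D i)) => //= r _ [] /eqP; rewrite subr_eq addrC -subr_eq subrr.
by move=> /eqP <-.
Qed.

(** * Atoms and the mass they carry *)

Definition zero_one_on_atoms := exists A0 : set T,
  [/\ A A0, P A0 = 1 &
      forall w, A0 w -> mu w (atom A w) = 0 \/ mu w (atom A w) = 1].

Lemma xsection_same_atom x : xsection (same_atom A) x = atom A x.
Proof.
apply/seteqP; split=> y; rewrite /xsection/= in_setE /same_atom/=.
  by move=> ->; exact: mem_atom.
exact: (atom_eq sA.1).
Qed.

Hypothesis mG : measurable (same_atom A).

Lemma measurable_atom w : measurable (atom A w).
Proof. by rewrite -xsection_same_atom; exact: measurable_xsection. Qed.

(** The set [B] cut by the atom of [x] is the section at [x] of [same_atom A] cut by the cylinder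
    over [B], whence measurability; constancy on atoms comes from the [A]-measurability of [mu]. *)
Lemma star_field_atom_mass B :
  measurable B -> measurable_wrt (star_field A) (atom_mass A mu B).
Proof.
move=> mB _ [Y mY <-]; rewrite setTI; apply/(star_fieldP sA.1); split;
  last first.
  move=> x y xy /=; rewrite /atom_mass -xy (eq_atom_cond_distr xy)//.
  by apply: measurableI => //; exact: measurable_atom.
have mGB : measurable (same_atom A `&` ([set: T] `*` B)).
  by apply: measurableI => //; exact: measurableX.
have := measurable_xsection_mass cond_distr_measurable mGB measurableT mY.
rewrite setTI; congr measurable; apply/seteqP; split=> x /=;
  by rewrite /atom_mass xsectionI xsection_same_atom in_xsectionX ?in_setT//
    setIC.
Qed.

Let S := atom_support A mu.

Lemma measurable_atom_support : measurable S.
Proof.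
have -> : S = atom_mass A mu [set: T] @^-1` `]0, +oo[%classic.
  by apply/seteqP; split=> w /=; rewrite in_itv/= andbT.
apply: (sigma_field_preimage (F := measurable)); last exact: emeasurable_itv.
by move=> E /(star_field_atom_mass measurableT)[].
Qed.

Lemma notin_atom_support w : ~ S w -> mu w (atom A w) = 0.
Proof.
move=> nSw; apply/eqP; rewrite eq_le measure_ge0 andbT leNgt; apply/negP => f0.
by apply: nSw; rewrite /S/atom_support/= /atom_mass setTI.
Qed.

(* For [x] in the support, the mass that [mu x] puts on the atom of [x] is a
   nonzero measure, so it determines this atom. *)
Lemma atom_mass_separates (D : seq nat -> set T) x y :
  D [::] = [set: T] -> setI_closed (range D) ->
  @measurable d T = <<s range D>> -> S x ->
  (forall s (q : rat), (ratr q)%:E < atom_mass A mu (D s) x <->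
                       (ratr q)%:E < atom_mass A mu (D s) y) ->
  atom A x = atom A y.
Proof.
move=> DT DI DE Sx Dxy.
pose m z : {measure set T -> \bar R}%R := mrestr (mu z) (measurable_atom z).
(* Finite measures agreeing on a generating pi-system that contains the whole space are equal; the
   rational thresholds recover the values on each [D s]. *)
have mxy : m x (atom A x) = m y (atom A x).
  apply: (measure_unique (range D) (fun=> [set: T])) => //.
  - by move=> _; exists [::].
  - by rewrite bigcup_const.
  - by move=> _ [s _ <-]; apply: eq_lte_rat => q; exact: Dxy.
  - by move=> _; rewrite /m /= /mrestr setTI ltey_eq fin_num_measure//;
    exact: measurable_atom.
  - exact: measurable_atom.
(* [m y] is carried by the atom of [y], so giving mass to the atom of [x] forces the two atoms to
   meet, hence to coincide. *)
have : m y (atom A x) != 0.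
  by rewrite -mxy /m /= /mrestr setIid -[X in mu x X]setTI gt_eqF.
apply: contraNP => nxy; rewrite /m /= /mrestr.
rewrite (_ : _ `&` _ = set0) ?measure0//; apply/seteqP; split=> // z [xz yz].
by apply: nxy; rewrite (atom_eq sA.1 xz) (atom_eq sA.1 yz).
Qed.

(** The support need not belong to [A], so an outer approximation replaces it: off [A2] the atoms
    have mass zero, and what [U] misses of [A2] is a null set in [A]. *)
Lemma support_hull U : completion_field P A S -> A U -> P (S `\` U) = 0 ->
  exists A2, [/\ A A2, S `<=` A2 & P (A2 `\` U) = 0].
Proof.
move=> [A1 [A2 [hA1 hA2 A1S SA2 A12]]] AU SU0; exists A2; split=> //.
have mS := measurable_atom_support.
apply: (@subset_measure0 _ _ _ P _ ((A2 `\` A1) `|` (S `\` U))).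
- by apply: measurableD; exact: mA.
- by apply: measurableU; apply: measurableD => //; exact: mA.
- move=> w [A2w Uw]; have [A1w|A1w] := pselect (A1 w); [right|left] => //.
  by split=> //; exact: A1S.
- by apply: null_set_setU => //; apply: measurableD => //; exact: mA.
Qed.

(* Almost surely [mu w (D i) = \1_(D i) w] for all [i] at once, and the
   complement of the atom of [w] is covered by countably many null sets. *)
Lemma separating_zero_one (I : countType) (D : I -> set T) (U : set T) :
  completion_field P A S -> A U -> P (S `\` U) = 0 ->
  (forall i, A (D i)) ->
  (forall x y, U x -> U y ->
     (forall i, D i x <-> D i y) -> atom A x = atom A y) ->
  zero_one_on_atoms.
Proof.
move=> cS AU SU0 AD sep.
have sF := sA.1.
(* [U] joins the family at index [None], so that off the exceptional set [mu w] gives [U] mass 1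
   whenever [w] lies in [U]. *)
have AD' (i : option I) : A (oapp D U i).
  by case: i => [i|]; [exact: AD|exact: AU].
have [N [AN N0 muD]] := cond_distr_indic_ae AD'.
have [A2 [hA2 SA2 A2U0]] := support_hull cS AU SU0.
(* Off [N'], a point outside [U] is outside [A2], hence outside the support, and its atom has mass
   zero. *)
pose N' := N `|` (A2 `\` U).
have AN' : A N' by apply: sigma_fieldU => //; exact: sigma_fieldD.
have N'0 : P N' = 0.
  by apply: null_set_setU => //; [exact: mA|apply: measurableD; exact: mA].
exists (~` N'); split; first exact: sigma_fieldC.
  by rewrite probability_setC ?N'0 ?sube0//; exact: mA.
move=> w /= /not_orP[nN nA2U].
have [Uw|nUw] := pselect (U w); last first.
  by left; apply: notin_atom_support => /SA2 A2w; apply: nA2U.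
right; have muw := muD w nN.
(* This set is the complement of [D i] if [w] lies in [D i], and [D i] itself otherwise; it is null
   for [mu w] either way. *)
have muI i : measurable [set x | ~ (D i w <-> D i x)] /\
    mu w [set x | ~ (D i w <-> D i x)] = 0.
  have mDi : measurable (D i) by exact: mA.
  have := muw (Some i); rewrite indicE; have [Dw|Dw] := pselect (D i w).
    rewrite mem_set// => muDi.
    rewrite (_ : mkset _ = ~` D i); last first.
      by apply/seteqP; split=> x /=; tauto.
    by rewrite probability_setC// muDi subee//; split=> //; exact: measurableC.
  rewrite (memNset Dw) => muDi; rewrite (_ : mkset _ = D i)//.
  by apply/seteqP; split=> x /=; [move=> ?; apply: contrapT|]; tauto.
have mH := measurable_atom w.
suff H0 : mu w (~` atom A w) = 0.
  have := probability_setC (mu w) (measurableC mH).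
  by rewrite setCK H0 sube0.
have mU := mA AU.
have UC0 : mu w (~` U) = 0.
  by rewrite probability_setC// (muw None) indicE mem_set// subee.
have mDw : measurable (\bigcup_i [set x | ~ (D i w <-> D i x)]).
  by apply: countable_bigcupT_measurable => // i; have [] := muI i.
apply: (@subset_measure0 _ _ _ (mu w) _
  (~` U `|` \bigcup_i [set x | ~ (D i w <-> D i x)])).
- exact: measurableC.
- by apply: measurableU => //; exact: measurableC.
- by apply: atomC_bigcup => x Ux; exact: sep.
- apply: null_set_setU => //.
  + exact: measurableC.
  + by apply: measure_bigcup_countType0 => i; have [] := muI i.
Qed.

(** On the support the mass of the atom is positive, so the zero-one alternative leaves only 1; the
    inner approximation [A1] of the support keeps [U] inside [A]. *)
Lemma zero_one_support_core : completion_field P A S -> zero_one_on_atoms ->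
  exists U, [/\ A U, U `<=` S, P (S `\` U) = 0 &
    forall w, U w -> mu w (atom A w) = 1].
Proof.
move=> [A1 [A2 [hA1 hA2 A1S SA2 A12]]] [A0 [hA0 PA0 f01]].
have sF := sA.1; have mS := measurable_atom_support.
have A0C : P (~` A0) = 0 by rewrite probability_setC ?PA0 ?subee//; exact: mA.
exists (A0 `&` A1); split.
- exact: sigma_fieldI.
- by move=> w [_ /A1S].
- apply: (@subset_measure0 _ _ _ P _ ((A2 `\` A1) `|` ~` A0)).
  + by apply: measurableD => //; apply: measurableI; exact: mA.
  + by apply: measurableU; [apply: measurableD|apply: measurableC]; exact: mA.
  + move=> w [Sw nU]; have [A0w|] := pselect (A0 w); last by right.
    by left; split; [exact: SA2|move=> A1w; apply: nU].
  + apply: null_set_setU => //; first by apply: measurableD; exact: mA.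
    by apply: measurableC; exact: mA.
- move=> w [/f01 fw /A1S]; rewrite /S /atom_support/= /atom_mass setTI.
  by case: fw => ->//; rewrite ltxx.
Qed.

(** * The core, where atoms have full mass *)

Section core.
Variable U : set T.
Hypothesis AU : A U.
Hypothesis muU : forall w, U w -> mu w (atom A w) = 1.

Let massU B w : measurable B -> U w -> atom_mass A mu B w = mu w B.
Proof.
move=> mB Uw; apply: probability1_setIr => //; last exact: muU.
exact: measurable_atom.
Qed.

(** A union of atoms contains the atom of [w] or misses it, and this atom carries the whole mass of
    [mu w]. *)
Lemma core_star_field B w : star_field A B -> U w -> (mu w B = 1 <-> B w).
Proof.
move=> /(star_fieldP sA.1)[mB satB] Uw; rewrite -(massU mB Uw) /atom_mass.
split=> [muB|Bw].
  have [[z [Bz /(atom_eq sA.1) wz]]|none] := pselect (B `&` atom A w !=set0).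
    exact: satB Bz.
  move: muB; rewrite (_ : B `&` _ = set0) ?measure0.
    by move=> /esym/eqP; rewrite onee_eq0.
  by apply/seteqP; split=> // z Bz; apply: none; exists z.
rewrite (_ : B `&` _ = atom A w); first exact: muU.
by apply/setIidr => z /(atom_eq sA.1) wz; exact: satB wz Bw.
Qed.

Lemma sub_star_field : A `<=` star_field A.
Proof.
move=> C hC; apply/(star_fieldP sA.1); split; first exact: mA.
by move=> x y /eq_atomP xy /xy; exact.
Qed.

Lemma core_strace : strace A U = strace (star_field A) U.
Proof.
apply/seteqP; split; first exact/subset_strace/sub_star_field.
move=> _ [B sB <-]; have [mB _] := sB.
(* This level set belongs to [A] and, by [core_star_field], has the same trace on [U] as [B]. *)
exists ((mu ^~ B) @^-1` [set 1]).
  exact: (sigma_field_preimage (cond_distr_wrt mB)).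
by apply/seteqP; split=> w /= [+ Uw]; move=> /(core_star_field sB Uw).
Qed.

(** The atom mass is [mu w B] on [U] and zero off the hull [A2]; only the null set between them is
    uncontrolled, so every preimage is squeezed between two sets of [A]. *)
Lemma core_atom_mass B : completion_field P A S -> P (S `\` U) = 0 ->
  measurable B -> measurable_wrt (completion_field P A) (atom_mass A mu B).
Proof.
move=> cS SU0 mB _ [Y mY <-]; rewrite setTI.
have [A2 [hA2 SA2 A2U0]] := support_hull cS AU SU0.
have sF := sA.1.
have f0 w : ~ A2 w -> atom_mass A mu B w = 0.
  move=> nA2; apply: (@subset_measure0 _ _ _ (mu w) _ (atom A w)) => //.
  - by apply: measurableI => //; exact: measurable_atom.
  - exact: measurable_atom.
  - by apply: notin_atom_support => /SA2.
(* The second piece accounts for the value zero off the hull, and is present only if [Y] contains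
   0. *)
pose E := (U `&` mu ^~ B @^-1` Y) `|` (~` (A2 `|` U) `&` [set _ | Y 0]).
have AE' : A E.
  apply: sigma_fieldU => //; apply: sigma_fieldI => //.
  - by apply: (sigma_field_preimage (cond_distr_wrt mB)).
  - by apply: sigma_fieldC => //; exact: sigma_fieldU.
  - have [Y0|Y0] := pselect (Y 0).
      rewrite (_ : mkset _ = setT); first exact: sigma_fieldT.
      by apply/seteqP; split.
    by rewrite (_ : mkset _ = set0); [case: sF|apply/seteqP; split].
exists E, (E `|` (A2 `\` U)); split=> //.
- by apply: sigma_fieldU => //; exact: sigma_fieldD.
- move=> w [[Uw /=]|[/= /not_orP[nA2 nU] Y0]]; first by rewrite massU.
  by rewrite f0.
- move=> w /= Yw; have [Uw|nU] := pselect (U w).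
    by left; left; split=> //=; rewrite -massU.
  have [A2w|nA2] := pselect (A2 w); first by right.
  left; right; split=> /=; first by case.
  by rewrite -(f0 w nA2).
- apply: subset_measure0 A2U0.
  + by apply: mA; apply: sigma_fieldD => //; apply: sigma_fieldU => //;
    exact: sigma_fieldD.
  + by apply: mA; exact: sigma_fieldD.
  + by move=> w [[]].
Qed.

End core.

(** * Level sets along a countable pi-system *)

Section generator.
Variable D : seq nat -> set T.
Hypothesis DT : D [::] = [set: T].
Hypothesis DI : setI_closed (range D).
Hypothesis DE : @measurable d T = <<s range D>>.

Let mD s : measurable (D s).
Proof. by rewrite DE; apply: sub_sigma_algebra; exists s. Qed.

(** The sets [B] with [mu ^~ B] measurable for [F] form a Dynkin system containing the pi-system. *)
Lemma cond_distr_generator (F : set (set T)) : sigma_algebra [set: T] F ->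
  (forall s (q : rat), F [set w | (ratr q)%:E < mu w (D s)]) ->
  forall B, measurable B -> measurable_wrt F (mu ^~ B).
Proof.
move=> sF FD B mB; apply/(measurable_wrtE _ sF); move: mB; rewrite {1}DE;
  move: B.
apply: dynkin_induction => //.
- rewrite (_ : mu ^~ _ = cst 1); first exact: measurable_cst.
  by apply/funext => w; exact: probability_setT.
- by move=> _ [s _ <-]; apply/(measurable_wrtE _ sF); exact: measurable_wrt_rat.
- move=> X mX mmuX; rewrite (_ : mu ^~ _ = (fun w => 1 - mu w X)).
    by apply: emeasurable_funB => //; exact: measurable_cst.
  by apply/funext => w; exact: probability_setC.
- move=> X mX tX mmuX.
  rewrite (_ : mu ^~ _ = (fun w => \sum_(i <oo | i \in xpredT) mu w (X i))).
    by apply: ge0_emeasurable_sum.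
  apply/funext => w; rewrite measure_bigcup//.
  by apply: eq_eseriesl => i; rewrite in_setT.
Qed.

(** On [U] a set [E] of [A] agrees with the level set where [mu w E = 1], and the countable family
    [G] already generates that level set. *)
Lemma core_countably_generated U : A U ->
  (forall w, U w -> mu w (atom A w) = 1) -> countably_generated U (strace A U).
Proof.
move=> AU muU; have sF := sA.1.
pose G := [set [set w | (ratr sq.2)%:E < mu w (D sq.1)] |
            sq in [set: seq nat * rat]].
have AG : G `<=` A.
  move=> _ [[s q] _ <-];
    rewrite (_ : mkset _ = mu ^~ (D s) @^-1` `](ratr q)%:E, +oo[).
    by apply: (sigma_field_preimage (cond_distr_wrt (mD s)));
      exact: emeasurable_itv.
  by apply/seteqP; split=> w /=; rewrite in_itv/= andbT.
have sU := sigma_algebra_strace U sF.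
exists (strace G U); split.
- apply: sub_countable; first exact: card_image_le.
  apply: sub_countable; first exact: card_image_le.
  exact: countableP.
- exact: subset_strace.
apply/seteqP; split; last by apply: smallest_sub => //; exact: subset_strace.
(* The sets whose trace on [U] is generated by the traces of [G] form a sigma-field containing
   [G]. *)
have trG : <<s G>> `<=` [set X | <<s U, strace G U>> (X `&` U)].
  apply: smallest_sub; last first.
    by move=> X GX; apply: sub_sigma_algebra; exists X.
  have [s0 sC sB] := smallest_sigma_algebra U (strace G U); split=> /=.
  - by rewrite set0I.
  - move=> X /sC; congr (<<s U, strace G U>> _).
    by apply/seteqP; split=> w /=; tauto.
  - by move=> X /sB; rewrite setI_bigcupl.
move=> _ [E AE' <-]; have mE := mA AE'.
rewrite (_ : E `&` U = (mu ^~ E @^-1` [set 1]) `&` U); last first.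
  apply/seteqP; split=> w /= [+ Uw];
  by move=> /(core_star_field muU (sub_star_field AE') Uw).
apply: trG; apply: sigma_field_preimage => //.
apply: cond_distr_generator mE => // s q.
by apply: sub_sigma_algebra; exists (s, q).
Qed.

(** The sets [E] are countably many and determine on [U] the atom masses of all [D s], so they
    separate the atoms there. Both [cond_a] and [cond_c] lead to [cond_3] this way. *)
Lemma atom_mass_zero_one U : completion_field P A S ->
  A U -> U `<=` S -> P (S `\` U) = 0 ->
  (forall s (q : rat), exists2 E, A E &
     forall w, U w -> (E w <-> (ratr q)%:E < atom_mass A mu (D s) w)) ->
  zero_one_on_atoms.
Proof.
move=> cS AU US SU0 H.
have /choice[E hE] : forall sq : seq nat * rat, exists E, A E /\
    forall w, U w -> (E w <-> (ratr sq.2)%:E < atom_mass A mu (D sq.1) w).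
  by move=> [s q]; have [E] := H s q; exists E.
apply: (separating_zero_one (D := E) cS AU SU0) => [i|x y Ux Uy Exy].
  by have [] := hE i.
apply: (atom_mass_separates DT DI DE (US _ Ux)) => s q.
have [_ hEsq] := hE (s, q).
by rewrite -(hEsq x Ux) -(hEsq y Uy).
Qed.

Lemma strace_star_zero_one U : completion_field P A S ->
  A U -> U `<=` S -> P (S `\` U) = 0 ->
  strace A U = strace (star_field A) U -> zero_one_on_atoms.
Proof.
move=> cS AU US SU0 AstarU; apply: (atom_mass_zero_one cS AU US SU0) => s q.
have : strace (star_field A) U
    (atom_mass A mu (D s) @^-1` `](ratr q)%:E, +oo[ `&` U).
  eexists; last reflexivity.
  by apply: (sigma_field_preimage (star_field_atom_mass (mD s)));
    exact: emeasurable_itv.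
rewrite -AstarU => -[E AE' /seteqP[EU UE]]; exists E => // w Uw;
  split=> [Ew|qw].
  by have [] := EU w (conj Ew Uw); rewrite /= in_itv/= andbT.
by have [] := UE w; first by split=> //=; rewrite in_itv/= andbT.
Qed.

Lemma completion_zero_one : completion_field P A S ->
  (forall B, measurable B ->
     measurable_wrt (completion_field P A) (atom_mass A mu B)) ->
  zero_one_on_atoms.
Proof.
move=> cS ma; have sF := sA.1.
have /choice[E hE] : forall sq : seq nat * rat, exists E : set T * set T,
    [/\ A E.1, A E.2,
      E.1 `<=` [set w | (ratr sq.2)%:E < atom_mass A mu (D sq.1) w],
      [set w | (ratr sq.2)%:E < atom_mass A mu (D sq.1) w] `<=` E.2 &
      P (E.2 `\` E.1) = 0].
  move=> [s q] /=.
  have mq : measurable (`](ratr q)%:E, +oo[ : set (\bar R)).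
    exact: emeasurable_itv.
  have [E1 [E2 [? ? E1f fE2 ?]]] :=
    sigma_field_preimage (ma _ (mD s)) mq.
  exists (E1, E2); split=> //= w.
    by move=> /E1f /=; rewrite in_itv/= andbT.
  by move=> qw; apply: fE2 => /=; rewrite in_itv/= andbT.
have [A1 [A2 [hA1 hA2 A1S SA2 A12]]] := cS.
(* Off these gaps each level set coincides with its inner approximation, a member of [A]. *)
pose N := \bigcup_i ((E i).2 `\` (E i).1).
have AN : A N.
  by apply: sigma_field_bigcup => // i; have [? ? _ _ _] := hE i;
    exact: sigma_fieldD.
have N0 : P N = 0.
  apply: measure_bigcup_countType0 => i; have [? ? _ _ PE] := hE i;
    last exact: PE.
  by apply: mA; exact: sigma_fieldD.
apply: (@atom_mass_zero_one (A1 `\` N) cS).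
- exact: sigma_fieldD.
- by move=> w [/A1S].
- apply: (@subset_measure0 _ _ _ P _ ((A2 `\` A1) `|` N)).
  + apply: measurableD; first exact: measurable_atom_support.
    by apply: mA; exact: sigma_fieldD.
  + by apply: mA; apply: sigma_fieldU => //; exact: sigma_fieldD.
  + move=> w [Sw nU]; have [Nw|nN] := pselect (N w); first by right.
    by left; split; [exact: SA2|move=> A1w; apply: nU].
  + by apply: null_set_setU => //; apply: mA => //; exact: sigma_fieldD.
move=> s q; have [? ? E1f fE2 _] := hE (s, q).
exists (E (s, q)).1 => // w [_ nN]; split; first exact: E1f.
move=> /fE2 E2w; apply: contrapT => nE1w; apply: nN.
by exists (s, q).
Qed.

End generator.

(** * Countably generated traces *)

Lemma countably_generated_zero_one U : completion_field P A S ->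
  A U -> P (S `\` U) = 0 -> countably_generated U (strace A U) ->
  zero_one_on_atoms.
Proof.
move=> cS AU SU0 [C [ctC CA UE]].
(* The default [U] is harmless: it belongs to [A] like the traces in [C]. *)
have [c [Cc cC]] := countable_enum U ctC.
apply: (separating_zero_one (D := c) cS AU SU0) => [i|x y Ux Uy cxy].
  have [->//|/CA[E AE' <-]] : (U |` C) (c i) by apply: cC; exists i.
  exact: (sigma_fieldI sA.1).
suff sep X : <<s U, C>> X -> (X x <-> X y).
  apply/eq_atomP => E AE'.
  have : <<s U, C>> (E `&` U) by rewrite -UE; exists E.
  by move=> trE; have [xy yx] := sep _ trE; split=> [Ex|Ey];
    [case: (xy (conj Ex Ux))|case: (yx (conj Ey Uy))].
(* As [x] and [y] lie in [U], the sets that do not tell them apart are stable under complement in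
   [U] and countable union. *)
suff: <<s U, C>> `<=` [set X | X x <-> X y] by exact.
apply: smallest_sub; last by move=> _ /Cc[i _ <-]; exact: cxy.
split=> [//|Z /= Zxy|Z Zxy] /=; first by tauto.
by split=> -[n _ /Zxy]; exists n.
Qed.

End regular_conditional_distribution.

(** * Assembling the equivalences *)

Theorem theorem4 (d : measure_display) (T : measurableType d) (R : realType)
    (P : probability T R) (A : set (set T)) (mu : T -> probability T R)
    (Bcg : countably_generated [set: T] (@measurable d T))
    (sA : sub_sigma_field A)
    (rmu : regular_cond_distr P A mu)
    (mG : measurable (same_atom A)) :
  let S := atom_support A mu in
  let cond_3 := exists A0 : set T,
    [/\ A A0, P A0 = 1 &
        forall w, A0 w -> mu w (atom A w) = 0 \/ mu w (atom A w) = 1] in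
  let cond_a := forall B : set T, measurable B ->
    measurable_wrt (completion_field P A) (atom_mass A mu B) in
  let cond_b := exists U : set T,
    [/\ A U, U `<=` S, P (S `\` U) = 0 & countably_generated U (strace A U)] in
  let cond_c := exists U : set T,
    [/\ A U, U `<=` S, P (S `\` U) = 0 & strace A U = strace (star_field A) U] in
  [/\ forall w : T, measurable (atom A w),
      forall B : set T, measurable B ->
        measurable_wrt (star_field A) (atom_mass A mu B) &
      completion_field P A S ->
        [/\ cond_c <-> cond_3, cond_c <-> cond_a & cond_c <-> cond_b]].
Proof.
move=> S cond_3 cond_a cond_b cond_c;
  have [D [DT DI DE]] := countable_pi_generator Bcg.
split; first exact: (measurable_atom sA).
  exact: (star_field_atom_mass sA rmu mG).
move=> cS.
(* [cond_3] is the hub: each condition implies it, and [core3] turns it into a set [U] with atoms of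
   full mass, from which the others follow. *)
have c3 : cond_c -> cond_3.
  case=> U [AU US SU0];
    exact: (strace_star_zero_one sA rmu mG DT DI DE cS AU US SU0).
have core3 := zero_one_support_core sA rmu mG cS.
have three_c : cond_3 -> cond_c.
  move=> /core3[U [AU US SU0 muU]]; exists U; split=> //.
  exact: (core_strace sA rmu mG).
split; split=> //.
- move=> /c3/core3[U [AU US SU0 muU]] B.
  exact: (core_atom_mass sA rmu mG AU muU cS SU0).
- by move=> /(completion_zero_one sA rmu mG DT DI DE cS).
- move=> /c3/core3[U [AU US SU0 muU]]; exists U; split=> //.
  exact: (core_countably_generated sA rmu mG DI DE AU).
- move=> [U [AU US SU0 cgU]]; apply: three_c.
  exact: (countably_generated_zero_one sA rmu mG cS AU SU0).
Qed.
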